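(* Let $\mathcal{T}$ be a (finite) Wang tile set and let $\Omega_{\mathcal{T}}$ be its Wang shift. If there exists a subset $M\subset\mathcal{T}$ of markers in the direction $\mathbf e_i\in\{\mathbf e_1,\mathbf e_2\}$, then there exist a Wang tile set $\mathcal{S}$ and a 2-dimensional morphism $\omega:\Omega_{\mathcal{S}}\to\Omega_{\mathcal{T}}$ such that $$\omega(\mathcal{S})\subseteq(\mathcal{T}\setminus M)\cup\left((\mathcal{T}\setminus M)\odot^i M\right),$$ which is recognizable in the Wang shift $\Omega_{\mathcal{S}}$ and surjective up to a shift, i.e., $\omega(\Omega_{\mathcal{S}})\cup\sigma^{\mathbf e_i}\omega(\Omega_{\mathcal{S}})=\Omega_{\mathcal{T}}$.
   Context: A Wang tile is a 4-tuple $\tau=(a,b,c,d)$ of colors, $a=\mathrm{right}(\tau)$, $b=\mathrm{top}(\tau)$, $c=\mathrm{left}(\tau)$, $d=\mathrm{bottom}(\tau)$. For a finite set $\mathcal{T}$ of Wang tiles, the Wang shift $\Omega_{\mathcal{T}}$ is the set of all $x:\mathbb{Z}^2\to\mathcal{T}$ with $\mathrm{right}(x(\mathbf n))=\mathrm{left}(x(\mathbf n+\mathbf e_1))$ and $\mathrm{top}(x(\mathbf n))=\mathrm{bottom}(x(\mathbf n+\mathbf e_2))$ for all $\mathbf n\in\mathbb{Z}^2$, where $\mathbf e_1=(1,0)$, $\mathbf e_2=(0,1)$. The shift action is $(\sigma^{\mathbf n}x)_{\mathbf m}=x_{\mathbf m+\mathbf n}$. A 2-dimensional word of shape $(n_1,n_2)\in\mathbb{N}^2$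 over $\mathcal{A}$ is a map $\{0,\dots,n_1-1\}\times\{0,\dots,n_2-1\}\to\mathcal{A}$; $\mathcal{A}^{*^2}$ is the set of all of them, and letters are identified with words of shape $(1,1)$. If the shapes of $u,v$ agree except possibly in coordinate $i$, $u\odot^i v$ denotes their concatenation in direction $\mathbf e_i$ ($u$ first, then $v$ at larger $i$-th coordinates). For sets $P,Q$ of letters, $P\odot^i Q=\{p\odot^i q: p\in P,q\in Q\}$. A set of words is forbidden in a subshift $X$ if none of its words occurs in an element of $X$. Markers: a nonempty proper subset $M\subset\mathcal{T}$ is called markers in the direction $\mathbf e_1$ if $M\odot^1M$, $M\odot^2(\mathcal{T}\setminus M)$ and $(\mathcal{T}\setminus M)\odot^2M$ are forbidden in $\Omega_{\mathcal{T}}$; it is called markers in the direction $\mathbf e_2$ if $M\odot^2M$, $M\odot^1(\mathcal{T}\setminus M)$ and $(\mathcal{T}\setminus M)\odot^1M$ are forbidden in $\Omega_{\mathcal{T}}$. A 2-dimensional morphism $\omega:X\to Y$ between $X\subseteq\mathcal{A}^{\mathbb{Z}^2}$ and $Y\subseteq\mathcal{B}^{\mathbb{Z}^2}$ is given by images $\omega(a)\in\mathcal{B}^{*^2}$ of letters $a\in\mathcal{A}$ such that for every $x\in X$ the images of any two letters of $x$ at positions $\mathbf n,\mathbf n+\mathbf e_i$ can be concatenated in direction $\mathbf e_i$; $\omega(x)$ is the configuration obtained by concatenating all the images, with the lower-left corner of $\omega(x_{\mathbf 0})$ at the origin, and $\omega(x)\in Y$. Recognizability: for $y\in\mathcal{B}^{\mathbb{Z}^2}$,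 a pair $(\mathbf k,x)$ with $x\in X$, $\mathbf k\in\mathbb{Z}^2$ and $y=\sigma^{\mathbf k}\omega(x)$ is an $\omega$-representation of $y$; it is centered if $\mathbf 0\le\mathbf k<\mathrm{shape}(\omega(x_{\mathbf 0}))$ coordinate-wise. $\omega$ is recognizable in $X$ if each $y\in\mathcal{B}^{\mathbb{Z}^2}$ has at most one centered $\omega$-representation $(\mathbf k,x)$ with $x\in X$. *)

(* Defs.v *)
From mathcomp Require Import all_boot all_order all_algebra finmap.
From mathcomp Require Import boolp classical_sets.

Set Implicit Arguments.
Unset Strict Implicit.
Unset Printing Implicit Defensive.

Import GRing.Theory.

Local Open Scope classical_set_scope.
Local Open Scope ring_scope.

Notation Z2 := (int * int)%type.

Inductive axis : Type := axis1 | axis2.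

Definition other_axis (i : axis) : axis :=
  match i with axis1 => axis2 | axis2 => axis1 end.

Definition e_ (i : axis) : Z2 :=
  match i with axis1 => (1, 0) | axis2 => (0, 1) end.

Definition config (A : Type) : Type := Z2 -> A.

Definition shift (A : Type) (n : Z2) (x : config A) : config A :=
  fun m => x (m + n).

(** The entry [(a, b)] of the matrix is the letter at the Cartesian position
    [(a, b)]: the first matrix index runs along [e_ axis1] and the second one
    along [e_ axis2]. A word may be empty in either direction. *)
Record word2 (A : Type) : Type := Word2 {
  width : nat;
  height : nat;
  entries : 'M[A]_(width, height) }.
Arguments Word2 {A width height} entries.

Definition letter (A : Type) (a : A) : word2 A :=
  Word2 (const_mx a : 'M[A]_(1, 1)).

Definition compatible (A : Type) (i : axis) (u v : word2 A) : Prop :=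
  match i with
  | axis1 => height u = height v
  | axis2 => width u = width v
  end.

(** Graph of the partial operation of concatenation in a given direction.
    Since the first matrix index is the first coordinate, concatenation along
    [axis1] is [col_mx]. *)
Inductive concat (A : Type) : axis -> word2 A -> word2 A -> word2 A -> Prop :=
| Concat1 (n1 m1 n2 : nat) (u : 'M[A]_(n1, n2)) (v : 'M[A]_(m1, n2)) :
    concat axis1 (Word2 u) (Word2 v) (Word2 (col_mx u v))
| Concat2 (n1 n2 m2 : nat) (u : 'M[A]_(n1, n2)) (v : 'M[A]_(n1, m2)) :
    concat axis2 (Word2 u) (Word2 v) (Word2 (row_mx u v)).

Definition concat_letters (A : Type) (i : axis) (P Q : set A) :
    set (word2 A) :=
  [set w | exists p q, [/\ P p, Q q & concat i (letter p) (letter q) w]].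

Definition occurs_at (A : Type) (w : word2 A) (x : config A) (n : Z2) : Prop :=
  forall (a : 'I_(width w)) (b : 'I_(height w)),
    x (n + (a%:Z, b%:Z)) = entries w a b.

Definition forbidden (A : Type) (L : set (word2 A)) (X : set (config A)) :
    Prop :=
  forall w x n, L w -> X x -> ~ occurs_at w x n.

(** A tile is [(right, top, left, bottom)]. *)
Definition wang_tile (C : Type) : Type := (C * C * C * C)%type.

Definition right (C : Type) (t : wang_tile C) : C := t.1.1.1.
Definition top (C : Type) (t : wang_tile C) : C := t.1.1.2.
Definition left (C : Type) (t : wang_tile C) : C := t.1.2.
Definition bottom (C : Type) (t : wang_tile C) : C := t.2.

Definition wang_shift (C : choiceType) (T : {fset wang_tile C}) :
    set (config T) :=
  [set x | forall n : Z2,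
     right (val (x n)) = left (val (x (n + e_ axis1))) /\
     top (val (x n)) = bottom (val (x (n + e_ axis2)))].
Arguments wang_shift {C} T _.

Definition markers (C : choiceType) (T : {fset wang_tile C}) (i : axis)
    (M : set T) : Prop :=
  [/\ M !=set0,
      M `<` setT,
      forbidden (concat_letters i M M) (wang_shift T),
      forbidden (concat_letters (other_axis i) M (~` M)) (wang_shift T) &
      forbidden (concat_letters (other_axis i) (~` M) M) (wang_shift T)].

(** [morph_graph w x y] states [y = w(x)]: [c n] is the lower-left corner of
    the block [w (x n)] in [y]. Consecutive blocks are adjacent, the block of
    index [0] starts at the origin, and the blocks cover the plane (which is
    automatic unless some images are empty words). *)
Definition morph_graph (A B : Type) (w : A -> word2 B) (x : config A)
    (y : config B) : Prop :=
  exists c : Z2 -> Z2,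
    [/\ c 0 = 0,
        forall n, c (n + e_ axis1) = c n + ((width (w (x n)))%:Z, 0),
        forall n, c (n + e_ axis2) = c n + (0, (height (w (x n)))%:Z),
        forall n, occurs_at (w (x n)) y (c n) &
        forall p, exists n (a : 'I_(width (w (x n))))
          (b : 'I_(height (w (x n)))), p = c n + (a%:Z, b%:Z)].

Lemma morph_graph_unique (A B : Type) (w : A -> word2 B) (x : config A)
    (y y' : config B) :
  morph_graph w x y -> morph_graph w x y' -> y = y'.
Proof.
move=> [c [c0 c1 c2 cy ccov]] [d [d0 d1 d2 dy _]].
have step i n : (c n = d n) <-> (c (n + e_ i) = d (n + e_ i)).
  by case: i; rewrite ?c1 ?d1 ?c2 ?d2; split=> [->|/addIr].
have e1 (m : int) : c (m, 0) = d (m, 0).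
  elim/int_ind: m => [|n IH|n IH]; first by rewrite c0 d0.
    have /step := IH => /(_ axis1).
    by have -> : (n%:Z, 0) + e_ axis1 = (n.+1%:Z, 0) :> Z2
      by congr pair => /=; rewrite -addn1 PoszD.
  apply/(step axis1).
  by have -> : (- n.+1%:Z, 0) + e_ axis1 = (- n%:Z, 0) :> Z2
    by congr pair => /=; rewrite -addn1 PoszD opprD addrNK.
have e2 (m k : int) : c (m, k) = d (m, k).
  elim/int_ind: k => [|n IH|n IH]; first exact: e1.
    have /step := IH => /(_ axis2).
    by have -> : (m, n%:Z) + e_ axis2 = (m, n.+1%:Z) :> Z2
      by congr pair => /=; rewrite ?addr0// -addn1 PoszD.
  apply/(step axis2).
  by have -> : (m, - n.+1%:Z) + e_ axis2 = (m, - n%:Z) :> Z2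
    by congr pair => /=; rewrite ?addr0// -addn1 PoszD opprD addrNK.
apply/funext => p; have [n [a [b ->]]] := ccov p.
by rewrite cy; case: n a b => m k a b; rewrite e2 dy.
Qed.

Definition is_morphism (A B : Type) (X : set (config A)) (Y : set (config B))
    (w : A -> word2 B) : Prop :=
  (forall x n i, X x -> compatible i (w (x n)) (w (x (n + e_ i)))) /\
  (forall x, X x -> exists2 y, morph_graph w x y & Y y).

Definition morph_image (A B : Type) (w : A -> word2 B) (X : set (config A)) :
    set (config B) :=
  [set y | exists2 x, X x & morph_graph w x y].

Definition representation (A B : Type) (X : set (config A)) (w : A -> word2 B)
    (y : config B) (k : Z2) (x : config A) : Prop :=
  X x /\ exists2 z, morph_graph w x z & y = shift k z.

Definition centered (A B : Type) (w : A -> word2 B) (k : Z2) (x : config A) :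
    Prop :=
  (0 <= k.1 < (width (w (x 0%R)))%:Z) /\ (0 <= k.2 < (height (w (x 0%R)))%:Z).

Definition recognizable (A B : Type) (X : set (config A)) (w : A -> word2 B) :
    Prop :=
  forall (y : config B) (k k' : Z2) (x x' : config A),
    representation X w y k x -> centered w k x ->
    representation X w y k' x' -> centered w k' x' ->
    k = k' /\ x = x'.

(* Main.v *)
Require Import Defs.
From mathcomp Require Import all_boot all_order all_algebra finmap.
From mathcomp Require Import boolp classical_sets.
From mathcomp Require Import zify.

Set Implicit Arguments.
Unset Strict Implicit.
Unset Printing Implicit Defensive.

Import Order.TTheory GRing.Theory Num.Theory.

Local Open Scope classical_set_scope.

(** Let [i] be the direction of the markers, and call the lines transverse to
    [i] columns. The markers condition across [i] says that a column of a
    configuration [y] of the Wang shift of [T] lies entirely in [M] or entirely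
    outside [M], and the condition along [i] that two adjacent columns do not
    both lie in [M] ([markers_column], [markers_alternate]). Gluing every
    column in [M] to the column before it cuts the plane into blocks: a tile
    outside [M], followed or not by a tile in [M]. These blocks form a
    configuration over a finite alphabet in which only neighbouring blocks
    constrain each other: consecutive blocks match along [i], and blocks
    stacked across [i] have the same length and match cell by cell. If the
    origin of [y] lies in [M], it is the second cell of its block, hence the
    union with the shift by [e_ i] ([layout_onto], [morph_image_block_word]).

    Conversely, expanding any such configuration of blocks gives a
    configuration of the Wang shift of [T] ([layout_exists], [layout_wang]).
    The blocks can be read off from the result, because a cell lies in [M] if
    and only if it is the second one of its block ([layout_inj]); the same
    remark at the origin determines the offset of a centered representation
    ([recognizable_block_word]).

    It remains to present the nearest-neighbour shift of blocks as a Wang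
    shift. Giving a glued pair the concatenation of the colors of its two tiles
    is not enough: two different pairs may have the same outer colors, since
    the color between the two tiles is lost, and then the morphism could not
    send one tile to both pairs. Instead, the color of an edge is the pair of
    blocks on its two sides ([edge_tiles]). A tile then remembers its own
    block, and reading it ([center]) is a bijection between the Wang shift and
    the shift of blocks ([center_nn_shift], [center_inj], [center_surj]), along
    which all the properties transfer. *)

(** * Nearest-neighbour shifts as Wang shifts *)

Definition nn_shift (A : Type) (E : axis -> rel A) : set (config A) :=
  [set x | forall k n, E k (x n) (x (n + e_ k)%R)].

Definition out_edge (C : Type) (k : axis) (t : wang_tile C) : C :=
  match k with axis1 => right t | axis2 => top t end.

Definition in_edge (C : Type) (k : axis) (t : wang_tile C) : C :=
  match k with axis1 => left t | axis2 => bottom t end.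

Definition adj (C : choiceType) (T : {fset wang_tile C}) (k : axis) : rel T :=
  fun t u => out_edge k (val t) == in_edge k (val u).

Lemma wang_shiftE (C : choiceType) (T : {fset wang_tile C}) :
  wang_shift T = nn_shift (@adj C T).
Proof.
apply/seteqP; split=> x /= xT => [k n | n].
  by apply/eqP; case: k; have [] := xT n.
by split; apply/eqP; [have := xT axis1 n | have := xT axis2 n].
Qed.

(** The color of an edge is the pair of letters on its two sides, in the order
    of the coordinates. [E] is imposed on the outgoing edges only, because each
    ingoing edge is an outgoing edge of another tile. *)
Definition edge_tile (B : finType) (E : axis -> rel B)
    (t : wang_tile (B * B)) : bool :=
  [&& (top t).1 == (right t).1, (left t).2 == (right t).1,
      (bottom t).2 == (right t).1, E axis1 (right t).1 (right t).2
    & E axis2 (top t).1 (top t).2].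

Definition edge_tiles (B : finType) (E : axis -> rel B) :
    {fset wang_tile (B * B)} :=
  [fset t : wang_tile (B * B) | edge_tile E t]%fset.

Definition center (B : finType) (E : axis -> rel B) (s : edge_tiles E) : B :=
  (right (val s)).1.
Arguments center {B E} s.

Lemma edge_tilesP (B : finType) (E : axis -> rel B) (s : edge_tiles E) k :
  [/\ (out_edge k (val s)).1 = center s, (in_edge k (val s)).2 = center s
    & E k (out_edge k (val s)).1 (out_edge k (val s)).2].
Proof.
have := valP s; rewrite /= in_fset inE /=.
by case/and5P=> /eqP top1 /eqP left2 /eqP bottom2 E1 E2; case: k.
Qed.

(** The first letter of an outgoing edge is the center of its tile, and matching
    edges make the second one the center of the next tile. *)
Lemma out_edge_wang (B : finType) (E : axis -> rel B)
    (x : config (edge_tiles E)) k n : wang_shift (edge_tiles E) x ->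
  out_edge k (val (x n)) = (center (x n), center (x (n + e_ k)%R)).
Proof.
rewrite wang_shiftE => xE; have /eqP xkn := xE k n.
have [<- _ _] := edge_tilesP (x n) k.
have [_ <- _] := edge_tilesP (x (n + e_ k)%R) k.
by rewrite -xkn -surjective_pairing.
Qed.

Lemma center_nn_shift (B : finType) (E : axis -> rel B) x :
  wang_shift (edge_tiles E) x -> nn_shift E (center \o x).
Proof.
move=> xE k n /=; have [_ _] := edge_tilesP (x n) k.
by rewrite (out_edge_wang k n xE).
Qed.

(** An outgoing edge depends on the centers by [out_edge_wang], and an ingoing
    edge is an outgoing edge of the preceding tile. *)
Lemma center_inj (B : finType) (E : axis -> rel B) x x' :
  wang_shift (edge_tiles E) x -> wang_shift (edge_tiles E) x' ->
  center \o x = center \o x' -> x = x'.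
Proof.
move=> xE xE' /funeqP eqx; apply/funext => n; apply: val_inj.
have eq_out k m : out_edge k (val (x m)) = out_edge k (val (x' m)).
  rewrite (out_edge_wang k m xE) (out_edge_wang k m xE').
  by congr pair; apply: eqx.
have eq_in k : in_edge k (val (x n)) = in_edge k (val (x' n)).
  move: xE xE'; rewrite wang_shiftE => xE xE'.
  have /eqP := xE k (n - e_ k)%R; have /eqP := xE' k (n - e_ k)%R.
  by rewrite subrK => <- <-; apply: eq_out.
move: (eq_out axis1 n) (eq_out axis2 n) (eq_in axis1) (eq_in axis2) => /=.
case: (val (x n)) => [[[? ?] ?] ?]; case: (val (x' n)) => [[[? ?] ?] ?].
by rewrite /right /left /top /bottom /= => -> -> -> ->.
Qed.

Lemma center_surj (B : finType) (E : axis -> rel B) z : nn_shift E z ->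
  exists2 x, wang_shift (edge_tiles E) x & center \o x = z.
Proof.
move=> zE.
pose t n : wang_tile (B * B) :=
  ((z n, z (n + e_ axis1)), (z n, z (n + e_ axis2)),
   (z (n - e_ axis1), z n), (z (n - e_ axis2), z n))%R.
have tE n : t n \in edge_tiles E.
  by rewrite in_fset inE /= /edge_tile /= !eqxx !zE.
exists (fun n => [` tE n]%fset); last by apply/funext.
by move=> n; split; rewrite /right /left /top /bottom /= addrK.
Qed.

Lemma morph_image_center (A : Type) (B : finType) (E : axis -> rel B)
    (w : B -> word2 A) :
  morph_image (w \o @center B E) (wang_shift (edge_tiles E)) =
  morph_image w (nn_shift E).
Proof.
apply/seteqP; split=> y [x xE xy].
  by exists (center \o x) => //; apply: center_nn_shift.
by have [z zE zx] := center_surj xE; exists z => //; rewrite -zx in xy.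
Qed.

Lemma is_morphism_center (A : Type) (B : finType) (E : axis -> rel B)
    (w : B -> word2 A) (Y : set (config A)) : is_morphism (nn_shift E) Y w ->
  is_morphism (wang_shift (edge_tiles E)) Y (w \o @center B E).
Proof.
move=> [compw imw]; split=> [x n k /center_nn_shift/compw | x].
  by apply.
by move/center_nn_shift/imw.
Qed.

Lemma recognizable_center (A : Type) (B : finType) (E : axis -> rel B)
    (w : B -> word2 A) : recognizable (nn_shift E) w ->
  recognizable (wang_shift (edge_tiles E)) (w \o @center B E).
Proof.
move=> recw y k k' x x' [xE [z zx yz]] cx [xE' [z' zx' yz']] cx'.
have repx : representation (nn_shift E) w y k (center \o x).
  by split; [apply: center_nn_shift | exists z].
have repx' : representation (nn_shift E) w y k' (center \o x').
  by split; [apply: center_nn_shift | exists z'].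
have [-> eqx] := recw y k k' _ _ repx cx repx' cx'.
by split=> //; apply: center_inj eqx.
Qed.

(** * Cutting the integers into intervals *)

Local Open Scope ring_scope.

(** [pos a] is the first point of the interval of index [a], and [l a] its
    length. *)
Definition cuts (l : int -> nat) (pos : int -> int) : Prop :=
  pos 0 = 0 /\ forall a : int, pos (a + 1) = pos a + (l a)%:Z.

Lemma int_step_ind (P : int -> Prop) : P 0 ->
  (forall a : int, P a -> P (a + 1)) -> (forall a : int, P (a + 1) -> P a) ->
  forall a, P a.
Proof.
move=> P0 Pup Pdown; elim/int_ind=> [//|n /Pup|n IH].
  by have -> : n%:Z + 1 = n.+1%:Z by lia.
by apply: Pdown; have -> : - n.+1%:Z + 1 = - n%:Z by lia.
Qed.

Lemma cuts_exist (l : int -> nat) : exists pos, cuts l pos.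
Proof.
exists (fun a => match a with
  | Posz n => \sum_(k < n) (l k%:Z)%:Z
  | Negz n => - \sum_(k < n.+1) (l (Negz k))%:Z end).
split=> [|[n|[|n]]]; first exact: big_ord0.
- have -> : n%:Z + 1 = n.+1%:Z by lia.
  by rewrite big_ord_recr.
- have -> : Negz 0 + 1 = Posz 0 by [].
  by rewrite /= big_ord0 big_ord1 addNr.
- have -> : Negz n.+1 + 1 = Negz n by rewrite !NegzE; lia.
  by rewrite [in RHS]/= [in RHS]big_ord_recr /= opprD subrK.
Qed.

Lemma cuts_cover l pos : cuts l pos -> (forall a, 0 < l a)%N ->
  forall p, exists a d, (d < l a)%N /\ p = pos a + d%:Z.
Proof.
move=> [pos0 posS] l_gt0; elim/int_step_ind => [|p|p] .
- by exists 0, 0%N; rewrite pos0.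
- move=> [a [d [dl ->]]]; have := posS a; have := l_gt0 (a + 1).
  case: (ltnP d.+1 (l a)) => dl' la1 posa.
    by exists a, d.+1; split=> //; lia.
  by exists (a + 1), 0%N; split=> //; lia.
- move=> [a [[|d] [dl eqp]]].
    exists (a - 1), (l (a - 1)).-1; have := l_gt0 (a - 1).
    by have := posS (a - 1); rewrite subrK; lia.
  by exists a, d; split; lia.
Qed.

Lemma cuts_le l pos (a a' : int) : cuts l pos -> a < a' ->
  pos (a + 1) <= pos a'.
Proof.
move=> [_ posS] lt_aa'; have [n ->] : exists n : nat, a' = a + 1 + n%:Z :> int.
  by exists (absz (a' - a - 1)%R); lia.
elim: n => [|n IH]; first by rewrite addr0.
have := posS (a + 1 + n%:Z).
have -> : a + 1 + n%:Z + 1 = a + 1 + n.+1%:Z by lia.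
move: IH; lia.
Qed.

Lemma cuts_uniq l pos (a a' : int) (d d' : nat) : cuts l pos ->
  (d < l a)%N -> (d' < l a')%N ->
  pos a + d%:Z = pos a' + d'%:Z -> a = a' /\ d = d'.
Proof.
move=> posP dl dl' eqp; have posS := posP.2.
case: (ltgtP a a') => [lt|gt|aa'].
- by have := cuts_le posP lt; have := posS a; lia.
- by have := cuts_le posP gt; have := posS a'; lia.
by split=> //; subst a'; lia.
Qed.

(** The points outside [D] are enumerated in order by iterating their successor
    and predecessor maps, which jump over at most one point of [D]. *)
Lemma complement_cuts (D : pred int) : ~~ D 0 ->
  (forall p : int, D p -> ~~ D (p + 1)) ->
  exists pos : int -> int,
    cuts (fun a => (D (pos a + 1)).+1) pos /\ forall a, ~~ D (pos a).
Proof.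
move=> D0 D2.
pose next p : int := p + (D (p + 1)).+1%:Z.
pose prev p : int := p - (D (p - 1)).+1%:Z.
have D_next p : ~~ D (next p).
  rewrite /next; case Dp: (D (p + 1)) => /=; last by rewrite Dp.
  by rewrite (_ : p + _ = p + 1 + 1); [apply: D2 | lia].
have D_prev p : ~~ D (prev p).
  rewrite /prev; case Dp: (D (p - 1)) => /=; last by rewrite Dp.
  apply/negP => /D2; rewrite (_ : p - _ + 1 = p - 1); last by lia.
  by rewrite Dp.
have prevK p : ~~ D p -> next (prev p) = p.
  move=> Dp; rewrite /next /prev; case Dp1: (D (p - 1)) => /=.
    rewrite (_ : p - _ + 1 = p - 1); last by lia.
    by rewrite Dp1; lia.
  rewrite (_ : p - _ + 1 = p); last by lia.
  by rewrite (negPf Dp); lia.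
pose pos a := match a with
  | Posz n => iter n next 0 | Negz n => iter n.+1 prev 0 end.
have D_pos a : ~~ D (pos a) by case: a => [[|n]|n] //=.
exists pos; split=> //; split=> // -[n|[|n]].
- by have -> : n%:Z + 1 = n.+1%:Z by lia.
- have -> : Negz 0 + 1 = Posz 0 by [].
  by rewrite -/(next _) prevK.
have -> : Negz n.+1 + 1 = Negz n by rewrite !NegzE; lia.
by rewrite -/(next _) [pos (Negz n.+1)]/= prevK //; apply: D_prev.
Qed.

(** * Coordinates along and across a direction *)

(** The point with coordinate [a] along [i] and [b] in the other direction;
    these coordinates let both directions of markers be treated at once. *)
Definition pt (i : axis) (a b : int) : Z2 :=
  match i with axis1 => (a, b) | axis2 => (b, a) end.

Definition along (i : axis) (n : Z2) : int :=
  match i with axis1 => n.1 | axis2 => n.2 end.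

Definition across (i : axis) (n : Z2) : int := along (other_axis i) n.

Lemma ptE i n : n = pt i (along i n) (across i n).
Proof. by case: i n => [] [a b]. Qed.

Lemma along_pt i a b : along i (pt i a b) = a.
Proof. by case: i. Qed.

Lemma across_pt i a b : across i (pt i a b) = b.
Proof. by case: i. Qed.

Lemma ptD i a b a' b' : pt i a b + pt i a' b' = pt i (a + a') (b + b').
Proof. by case: i. Qed.

Lemma e_along i : e_ i = pt i 1 0. Proof. by case: i. Qed.

Lemma e_across i : e_ (other_axis i) = pt i 0 1. Proof. by case: i. Qed.

Lemma nn_shift_shift (A : Type) (E : axis -> rel A) k x :
  nn_shift E x -> nn_shift E (shift k x).
Proof. by move=> xE l n; have := xE l (n + k); rewrite /shift addrAC. Qed.

Lemma nn_shiftP (A : Type) (E : axis -> rel A) i (x : config A) :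
  nn_shift E x <-> forall a b : int, E i (x (pt i a b)) (x (pt i (a + 1) b)) /\
     E (other_axis i) (x (pt i a b)) (x (pt i a (b + 1))).
Proof.
split=> [xE a b | xE k n].
  have := xE i (pt i a b); have := xE (other_axis i) (pt i a b).
  by rewrite e_across e_along !ptD !addr0.
have [] := xE (along i n) (across i n); rewrite -ptE.
have -> : pt i (along i n + 1) (across i n) = n + e_ i.
  by rewrite {3}(ptE i n) e_along ptD addr0.
have -> : pt i (along i n) (across i n + 1) = n + e_ (other_axis i).
  by rewrite {3}(ptE i n) e_across ptD addr0.
by case: i k {xE} => [] [].
Qed.

(** * Words made of two letters *)

Definition pair_word (A : Type) (k : axis) (p q : A) : word2 A :=
  match k with
  | axis1 => Word2 (col_mx (const_mx p : 'M_(1, 1)) (const_mx q : 'M_(1, 1)))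
  | axis2 => Word2 (row_mx (const_mx p : 'M_(1, 1)) (const_mx q : 'M_(1, 1)))
  end.

Lemma concat_pair_word (A : Type) k (p q : A) :
  concat k (letter p) (letter q) (pair_word k p q).
Proof. by case: k; constructor. Qed.

Lemma occurs_letter (A : Type) (t : A) x n :
  occurs_at (letter t) x n <-> x n = t.
Proof.
split=> [xn|<- a b].
  by have := xn ord0 ord0; rewrite mxE -[(_, _)]/(0 : Z2) addr0.
by rewrite (ord1 a) (ord1 b) mxE -[(_, _)]/(0 : Z2) addr0.
Qed.

Lemma occurs_pair_word (A : Type) k (p q : A) x n :
  occurs_at (pair_word k p q) x n <-> x n = p /\ x (n + e_ k) = q.
Proof.
case: k; split.
- move=> xn; have := xn (lshift 1 ord0) ord0; have := xn (rshift 1 ord0) ord0.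
  by rewrite /= col_mxEu col_mxEd !mxE /= -[(0, 0)]/(0 : Z2) addr0.
- move=> [<- <-] a b; rewrite /= -(splitK a) (ord1 b).
  case: (split a) => k; rewrite (ord1 k) /= ?col_mxEu ?col_mxEd mxE //.
  by rewrite -[(_, _)]/(0 : Z2) addr0.
- move=> xn; have := xn ord0 (lshift 1 ord0); have := xn ord0 (rshift 1 ord0).
  by rewrite /= row_mxEl row_mxEr !mxE /= -[(0, 0)]/(0 : Z2) addr0.
- move=> [<- <-] a b; rewrite /= -(splitK b) (ord1 a).
  case: (split b) => k; rewrite (ord1 k) /= ?row_mxEl ?row_mxEr mxE //.
  by rewrite -[(_, _)]/(0 : Z2) addr0.
Qed.

Lemma forbidden_pair (A : Type) k (P Q : set A) X x n :
  forbidden (concat_letters k P Q) X -> X x -> P (x n) -> ~ Q (x (n + e_ k)).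
Proof.
move=> forb Xx Pn Qn.
apply: (forb (pair_word k (x n) (x (n + e_ k))) x n) => //.
  by exists (x n), (x (n + e_ k)); split=> //; apply: concat_pair_word.
exact/occurs_pair_word.
Qed.

(** * Blocks and their configurations *)

Section Blocks.
Variables (C : choiceType) (T : {fset wang_tile C}) (i : axis) (M : set T).

Definition fusible (b : T * option T) : bool :=
  (b.1 \notin M) && if b.2 is Some m then (m \in M) && adj i b.1 m else true.

Definition block := {b : T * option T | fusible b}.

Definition base (b : block) : T := (val b).1.

Definition marker (b : block) : option T := (val b).2.

Definition len (b : block) : nat := (isSome (marker b)).+1.

(** The junk value at a missing second cell is the base itself, so that
    [stacked] can test two cells whatever the length. *)
Definition cell (b : block) (d : nat) : T :=
  if d is _.+1 then odflt (base b) (marker b) else base b.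

Definition beside (b b' : block) : bool := adj i (cell b (len b).-1) (base b').

Definition stacked (b b' : block) : bool :=
  [&& len b == len b', adj (other_axis i) (cell b 0) (cell b' 0)
    & adj (other_axis i) (cell b 1) (cell b' 1)].

Definition block_adj (k : axis) : rel block :=
  match i, k with
  | axis1, axis1 | axis2, axis2 => beside
  | _, _ => stacked
  end.

Lemma block_adj_along : block_adj i = beside.
Proof. by rewrite /block_adj; case: i. Qed.

Lemma block_adj_across : block_adj (other_axis i) = stacked.
Proof. by rewrite /block_adj; case: i. Qed.

Lemma base_notin b : base b \notin M.
Proof. by have /andP[] := valP b. Qed.

Lemma marker_in b m : marker b = Some m -> m \in M /\ adj i (base b) m.
Proof.
by have /andP[_] := valP b; rewrite /marker => + bm; rewrite bm => /andP.
Qed.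

(** What makes a factorization into blocks unique. *)
Lemma cell_in b d : (d < len b)%N -> (cell b d \in M) = (0 < d)%N.
Proof.
rewrite /len; case: d => [_|[|d]] /=; first by rewrite (negPf (base_notin b)).
  by case Db: (marker b) => [m|//] _ /=; have [] := marker_in Db.
by case: (marker b).
Qed.

Definition block_word (b : block) : word2 T :=
  if marker b is Some m then pair_word i (base b) m else letter (base b).

Definition extent (k : axis) (u : word2 T) : nat :=
  match k with axis1 => width u | axis2 => height u end.

Lemma extent_along b : extent i (block_word b) = len b.
Proof.
by rewrite /block_word /len; case: (marker b) => [m|]; case: i.
Qed.

Lemma extent_across b : extent (other_axis i) (block_word b) = 1%N.
Proof.
by rewrite /block_word /len; case: (marker b) => [m|]; case: i.
Qed.

Lemma occurs_block_word b y p q : occurs_at (block_word b) y (pt i p q) <->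
  forall d, (d < len b)%N -> y (pt i (p + d%:Z) q) = cell b d.
Proof.
rewrite /block_word /cell /len; case: (marker b) => [m|] /=.
  rewrite occurs_pair_word e_along ptD addr0; split=> [[yp yp1] [|[|]] //|yp].
    by rewrite addr0.
  by split; [rewrite -[p]addr0; apply: (yp 0%N) | apply: (yp 1%N)].
rewrite occurs_letter; split=> [yp [|//] _|yp]; first by rewrite addr0.
by rewrite -[p]addr0; apply: (yp 0%N).
Qed.

Lemma cover_block_word b (c p : Z2) :
  (exists (u : 'I_(width (block_word b))) (v : 'I_(height (block_word b))),
    p = c + (u%:Z, v%:Z)) <->
  (exists2 d, (d < len b)%N & p = c + pt i d%:Z 0).
Proof.
have := extent_along b; have := extent_across b.
case: (block_word b) => w h u0 /=; rewrite /extent /pt.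
case: i => /= ->; move=> <-; split.
- by move=> [u [v ->]]; exists u => //; rewrite (ord1 v).
- by move=> [d dw ->]; exists (Ordinal dw), ord0.
- by move=> [u [v ->]]; exists v => //; rewrite (ord1 u).
- by move=> [d dh ->]; exists ord0, (Ordinal dh).
Qed.

(** Translates the recurrence of [morph_graph] on the corners of the words into
    the coordinates of the direction [i]. *)
Lemma corner_steps (u : config (word2 T)) (l : Z2 -> nat) (c : Z2 -> Z2) :
  (forall n, extent i (u n) = l n) ->
  (forall n, extent (other_axis i) (u n) = 1%N) ->
  (forall n, c (n + e_ axis1) = c n + ((width (u n))%:Z, 0)) /\
  (forall n, c (n + e_ axis2) = c n + (0, (height (u n))%:Z)) <->
  (forall n, c (n + e_ i) = c n + pt i (l n)%:Z 0) /\
  (forall n, c (n + e_ (other_axis i)) = c n + pt i 0 1).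
Proof.
move=> ul u1; have {}u1 n : (extent (other_axis i) (u n))%:Z = 1 :> int.
  by rewrite u1.
case: i ul u1 => /= ul u1; split=> -[c1 c2]; split=> n;
by rewrite ?c1 ?c2 ?ul ?u1.
Qed.

(** [pos a] is the first coordinate along [i] of the blocks of column [a]. A
    single function [pos] for all rows forces the blocks of a column of [z] to
    have the same length. *)
Definition layout (z : config block) (y : config T) (pos : int -> int) : Prop :=
  pos 0 = 0 /\ forall a b : int,
    pos (a + 1) = pos a + (len (z (pt i a b)))%:Z /\
    forall d, (d < len (z (pt i a b)))%N ->
      y (pt i (pos a + d%:Z) b) = cell (z (pt i a b)) d.

Lemma layout_cuts z y pos b : layout z y pos ->
  cuts (fun a => len (z (pt i a b))) pos.
Proof. by move=> [pos0 zy]; split=> // a; have [] := zy a b. Qed.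

Lemma layout_cell z y pos p b : layout z y pos ->
  exists a d, [/\ p = pos a + d%:Z, (d < len (z (pt i a b)))%N
    & y (pt i p b) = cell (z (pt i a b)) d].
Proof.
move=> zy; have [//|a [d [dl ->]]] := cuts_cover (layout_cuts b zy) _ p.
by exists a, d; split=> //; have [_] := zy.2 a b; apply.
Qed.

(** All the blocks have extent [1] across [i], so the corner of index
    [pt i a b] has coordinate [b] across [i], and its coordinate along [i] does
    not depend on [b]. *)
Lemma morph_graph_layout z y :
  morph_graph block_word z y <-> exists pos, layout z y pos.
Proof.
have steps c := corner_steps c (fun n => extent_along (z n))
  (fun n => extent_across (z n)).
split=> [[c [c0 c1 c2 cy _]]|[pos zy]].
  have [ci cj] := (steps c).1 (conj c1 c2).
  pose pos a := along i (c (pt i a 0)).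
  have c_row a : c (pt i a 0) = pt i (pos a) 0.
    rewrite [LHS](ptE i) -/(pos a); congr pt.
    elim/int_step_ind: a => [|a|a]; first by case: (i) c0 => /= ->.
      have := ci (pt i a 0); rewrite e_along ptD addr0 => -> IH.
      by rewrite (ptE i (c _)) IH ptD across_pt addr0.
    have := ci (pt i a 0); rewrite e_along ptD addr0 => ->.
    by rewrite {1}(ptE i (c _)) ptD across_pt addr0.
  have cE a b : c (pt i a b) = pt i (pos a) b.
    elim/int_step_ind: b => [//|b IH|b].
      have := cj (pt i a b); rewrite e_across ptD addr0 => ->.
      by rewrite IH ptD addr0.
    have := cj (pt i a b); rewrite e_across ptD addr0 => -> eqc.
    by rewrite -[LHS](addrK (pt i 0 1)) eqc; case: i; congr pair;
      rewrite /= ?subr0 ?addrK.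
  exists pos; split=> [|a b].
    by rewrite /pos; case: (i) c0 => /= ->.
  split; last by apply/occurs_block_word; rewrite -cE.
  have := ci (pt i a b); rewrite e_along ptD addr0 !cE ptD addr0.
  by move/(congr1 (along i)); rewrite !along_pt.
have [pos0 posP] := zy.
exists (fun n => pt i (pos (along i n)) (across i n)).
have [|c1 c2] := (steps (fun n => pt i (pos (along i n)) (across i n))).2.
  split=> n; rewrite (ptE i n); move: (along i n) (across i n) => a b;
  rewrite ?e_across ?e_along !ptD !along_pt !across_pt !addr0 //.
  by have [-> _] := posP a b.
split=> //.
- by rewrite /across; case: i pos0 => /= ->.
- move=> n; apply/occurs_block_word; have [_] := posP (along i n) (across i n).
  by rewrite -ptE.
move=> p; have [a [d [pa dl _]]] := layout_cell (along i p) (across i p) zy.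
exists (pt i a (across i p)); apply/cover_block_word; exists d => //.
by rewrite along_pt across_pt ptD -pa addr0 -ptE.
Qed.

Lemma block_shiftP z : nn_shift block_adj z <->
  forall a b : int, beside (z (pt i a b)) (z (pt i (a + 1) b)) /\
    stacked (z (pt i a b)) (z (pt i a (b + 1))).
Proof. by rewrite (nn_shiftP _ i) block_adj_along block_adj_across. Qed.

Lemma len_column z a b : nn_shift block_adj z ->
  len (z (pt i a b)) = len (z (pt i a 0)).
Proof.
move=> /block_shiftP zL.
have step c : len (z (pt i a c)) = len (z (pt i a (c + 1))).
  by have [_ /and3P[/eqP]] := zL a c.
by elim/int_step_ind: b => [//|b|b]; rewrite -step.
Qed.

Lemma layout_exists z : nn_shift block_adj z -> exists y pos, layout z y pos.
Proof.
move=> zL; have [pos posP] := cuts_exist (fun a => len (z (pt i a 0))).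
have cover p : exists cd : int * nat,
    (cd.2 < len (z (pt i cd.1 0)))%N /\ p = pos cd.1 + cd.2%:Z.
  by have [//|a [d ad]] := cuts_cover posP _ p; exists (a, d).
have [cd cdP] := choice cover.
exists (fun n =>
  cell (z (pt i (cd (along i n)).1 (across i n))) (cd (along i n)).2).
exists pos; split=> [|a b]; first exact: posP.1.
rewrite len_column //; split=> [|d dl]; first exact: posP.2.
rewrite along_pt across_pt; have [dl' eqp] := cdP (pos a + d%:Z).
by have [<- <-] := cuts_uniq posP dl dl' eqp.
Qed.

(** Two adjacent cells along [i] are matched inside a block by [fusible] and
    across a border by [beside]; across [i] they have the same rank in stacked
    blocks. *)
Lemma layout_wang z y pos : nn_shift block_adj z -> layout z y pos ->
  wang_shift T y.
Proof.
move=> /block_shiftP zL zy; rewrite wang_shiftE; apply/(nn_shiftP _ i) => p b.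
have [a [d [-> dl yp]]] := layout_cell p b zy; rewrite yp.
have [beside_a /and3P[/eqP len_a adj0 adj1]] := zL a b.
have [posS _] := zy.2 a b; split; last first.
  have [_ ->] := zy.2 a (b + 1); last by rewrite -len_a.
  by move: dl; rewrite /len; case: d {yp} => [|[|d]] //; case: (marker _).
case: (ltnP d.+1 (len (z (pt i a b)))) => dl'.
  have -> : pos a + d%:Z + 1 = pos a + d.+1%:Z by lia.
  have [_ ->] := zy.2 a b; last by [].
  move: dl' {yp dl}; rewrite /len; case Dm: (marker _) => [m|//].
  by case: d => // _; rewrite /= Dm /=; have [] := marker_in Dm.
have -> : pos a + d%:Z + 1 = pos (a + 1) + 0%:Z by lia.
have [_ ->] := zy.2 (a + 1) b; last by [].
by have -> : d = (len (z (pt i a b))).-1 by lia.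
Qed.

(** The cell after the base is in [M] if it belongs to the same block, and is
    the base of the next block otherwise. *)
Lemma layout_len z y pos a b : layout z y pos ->
  len (z (pt i a b)) = (y (pt i (pos a + 1) b) \in M).+1.
Proof.
move=> zy; have [posS za] := zy.2 a b.
case: (ltnP 1 (len (z (pt i a b)))) => l1.
  rewrite (za 1%N l1) cell_in //.
  by move: l1; rewrite /len; case: (marker _).
have l1' : len (z (pt i a b)) = 1%N by move: l1; rewrite /len; case: (marker _).
have -> : pos a + 1 = pos (a + 1) + 0%:Z by lia.
by have [_ ->] := zy.2 (a + 1) b; rewrite // cell_in.
Qed.

(** The block that ends just before a border is read from its last cell. *)
Lemma layout_len_pred z y pos a b : layout z y pos ->
  len (z (pt i a b)) = (y (pt i (pos (a + 1) - 1) b) \in M).+1.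
Proof.
move=> zy; have [posS za] := zy.2 a b.
have -> : pos (a + 1) - 1 = pos a + (len (z (pt i a b))).-1%:Z.
  by rewrite posS /len /=; lia.
by rewrite za // cell_in // /len; case: (marker _).
Qed.

Lemma layout_block z y pos a b : layout z y pos ->
  val (z (pt i a b)) = (y (pt i (pos a) b),
    if y (pt i (pos a + 1) b) \in M then Some (y (pt i (pos a + 1) b))
    else None).
Proof.
move=> zy; have [_ za] := zy.2 a b.
have := layout_len a b zy; have := za 0%N isT; rewrite addr0 => -> zlen.
rewrite [LHS]surjective_pairing; congr pair; rewrite -/(marker _).
move: zlen (za 1%N); rewrite /len /=; case: (marker _) => [m|] /=.
  by case: (_ \in M) => // _ ->.
by case: (_ \in M).
Qed.

(** Starting from the common border [0], [layout_len] determines the borders in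
    the positive direction and [layout_len_pred] in the negative one. *)
Lemma layout_inj z z' y pos pos' :
  layout z y pos -> layout z' y pos' -> z = z'.
Proof.
move=> zy zy'; have eq_pos a : pos a = pos' a.
  elim/int_step_ind: a => [|a IH|a IH]; first by rewrite zy.1 zy'.1.
    have [-> _] := zy.2 a 0; have [-> _] := zy'.2 a 0.
    by rewrite (layout_len a 0 zy) (layout_len a 0 zy') IH.
  have [+ _] := zy.2 a 0; have [+ _] := zy'.2 a 0.
  by rewrite (layout_len_pred a 0 zy) (layout_len_pred a 0 zy') IH; lia.
apply/funext => n; rewrite (ptE i n); apply: val_inj.
by rewrite (layout_block _ _ zy) (layout_block _ _ zy') eq_pos.
Qed.

Lemma centered_pt k z : centered block_word k z ->
  exists2 d, (d < len (z 0%R))%N & k = pt i d%:Z 0.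
Proof.
rewrite /centered -(extent_along (z 0%R)).
have : (extent (other_axis i) (block_word (z 0%R)))%:Z = 1.
  by rewrite extent_across.
rewrite /extent; case: k i (block_word (z 0%R)) => k1 k2 [] u /= -> [k1P k2P].
  exists (absz k1); first lia.
  by congr pair; lia.
exists (absz k2); first lia.
by congr pair; lia.
Qed.

Lemma recognizable_block_word : recognizable (nn_shift block_adj) block_word.
Proof.
move=> y k k' z z' [zL [w zw yw]] ck [zL' [w' zw' yw']] ck'.
have [pos zP] := (morph_graph_layout z w).1 zw.
have [pos' zP'] := (morph_graph_layout z' w').1 zw'.
have [d dl Dk] := centered_pt ck; have [d' dl' Dk'] := centered_pt ck'.
have pt0 : 0 = pt i 0 0 by case: (i).
have y0 : y 0%R = cell (z 0%R) d.
  rewrite yw /shift add0r Dk.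
  by have [_] := zP.2 0 0; rewrite -pt0 zP.1 => /(_ d dl); rewrite add0r.
have y0' : y 0%R = cell (z' 0%R) d'.
  rewrite yw' /shift add0r Dk'.
  by have [_] := zP'.2 0 0; rewrite -pt0 zP'.1 => /(_ d' dl'); rewrite add0r.
(* Both are the rank of the origin in its block, read from [y 0] in [M]. *)
have dd' : d = d'.
  have : (0 < d)%N = (0 < d')%N by rewrite -(cell_in dl) -(cell_in dl') -y0 y0'.
  move: dl dl'; rewrite /len; do 2!case: (marker _) => [?|] /=; lia.
have kk' : k = k' by rewrite Dk Dk' dd'.
split=> //; apply: (layout_inj zP).
have -> : w = w'; last exact: zP'.
apply/funext => n; move/funeqP/(_ (n - k)): yw; rewrite yw' /shift -kk'.
by rewrite !subrK.
Qed.

Lemma is_morphism_block_word :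
  is_morphism (nn_shift block_adj) (wang_shift T) block_word.
Proof.
split=> [z n k zL|z zL].
  have compatibleP u v : extent (other_axis k) u = extent (other_axis k) v ->
    compatible k u v by case: k.
  apply: compatibleP; have : k = i \/ k = other_axis i.
    by case: k i => [] []; auto.
  case=> ->; first by rewrite !extent_across.
  have -> : other_axis (other_axis i) = i by case: (i).
  rewrite !extent_along; have := zL (other_axis i) n.
  by rewrite block_adj_across => /and3P[/eqP].
have [y [pos zy]] := layout_exists zL; exists y.
  by apply/morph_graph_layout; exists pos.
exact: layout_wang zy.
Qed.

Lemma block_word_range :
  range block_word `<=` (@letter T @` (~` M)) `|` concat_letters i (~` M) M.
Proof.
move=> _ [b _ <-]; rewrite /block_word.
have baseP : (~` M) (base b) by move=> /mem_set; apply/negP/base_notin.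
case Dm: (marker b) => [m|]; last by left; exists (base b).
right; exists (base b), m; split=> //; last exact: concat_pair_word.
by have [/set_mem] := marker_in Dm.
Qed.

Hypothesis markersM : markers i M.

Lemma markers_column y p b : wang_shift T y ->
  (y (pt i p b) \in M) = (y (pt i p 0) \in M).
Proof.
move=> yT; have [_ _ _ forb forb'] := markersM.
have step c : (y (pt i p c) \in M) = (y (pt i p (c + 1)) \in M).
  have -> : pt i p (c + 1) = pt i p c + e_ (other_axis i).
    by rewrite e_across ptD addr0.
  apply/idP/idP => /set_mem yM; apply: contrapT => yN.
    by apply: (forbidden_pair forb yT yM) => /mem_set.
  by apply: (forbidden_pair forb' yT _ yM) => /mem_set.
by elim/int_step_ind: b => [//|b|b]; rewrite -step.
Qed.

Lemma markers_alternate y n : wang_shift T y -> y n \in M ->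
  y (n + e_ i) \notin M.
Proof.
move=> yT /set_mem yn; have [_ _ forb _ _] := markersM.
by apply/negP => /set_mem; apply: forbidden_pair forb yT yn.
Qed.

(** The borders are the columns outside [M]. The column of the origin has to be
    one of them, since [layout] puts a border at [0]. *)
Lemma layout_onto y : wang_shift T y -> y 0%R \notin M ->
  exists2 z, nn_shift block_adj z & exists pos, layout z y pos.
Proof.
move=> yT y0; pose D p := y (pt i p 0) \in M.
have [||pos [posP D_pos]] := @complement_cuts D.
- by have -> : D 0 = (y 0%R \in M) by rewrite /D; case: (i).
- move=> p /(markers_alternate yT); rewrite e_along ptD addr0; apply.
have yE k n : adj k (y n) (y (n + e_ k)).
  by move: yT n; rewrite wang_shiftE => /(_ k).
pose read a b := (y (pt i (pos a) b),
  if D (pos a + 1) then Some (y (pt i (pos a + 1) b)) else None).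
have readP a b : fusible (read a b).
  rewrite /fusible /= (markers_column _ _ yT) D_pos /=.
  case: ifP => // Dp; rewrite (markers_column _ _ yT) -/(D _) Dp /=.
  by have := yE i (pt i (pos a) b); rewrite e_along ptD addr0.
pose z n : block := exist fusible _ (readP (along i n) (across i n)).
have zE a b : val (z (pt i a b)) = read a b by rewrite /= along_pt across_pt.
have lenE a b : len (z (pt i a b)) = (D (pos a + 1)).+1.
  by rewrite /len /marker zE /=; case: (D _).
have zy : layout z y pos.
  split=> [|a b]; first exact: posP.1.
  rewrite lenE; split=> [|d]; first exact: posP.2.
  rewrite /cell /base /marker zE /=.
  by case: (D _) d => -[|[|d]] //=; rewrite addr0.
exists z; last by exists pos.
apply/block_shiftP => a b; split.
  have [posS za] := zy.2 a b; rewrite /beside -za //.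
  rewrite /base zE /= posS.
  have := yE i (pt i (pos a + (len (z (pt i a b))).-1%:Z) b).
  rewrite e_along ptD addr0.
  by have -> : pos a + (len (z (pt i a b))).-1%:Z + 1 =
    pos a + (len (z (pt i a b)))%:Z by rewrite /len /=; lia.
have yS p : adj (other_axis i) (y (pt i p b)) (y (pt i p (b + 1))).
  by have := yE (other_axis i) (pt i p b); rewrite e_across ptD addr0.
rewrite /stacked !lenE eqxx /cell /base /marker !zE /= yS /=.
by case: (D _); apply: yS.
Qed.

Lemma morph_image_block_word :
  morph_image block_word (nn_shift block_adj)
    `|` (shift (e_ i) @` morph_image block_word (nn_shift block_adj)) =
  wang_shift T.
Proof.
have imT : morph_image block_word (nn_shift block_adj) `<=` wang_shift T.
  by move=> y [z zL /morph_graph_layout[pos]]; apply: layout_wang.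
have onto y : wang_shift T y -> y 0%R \notin M ->
    morph_image block_word (nn_shift block_adj) y.
  move=> yT y0; have [z zL zy] := layout_onto yT y0.
  by exists z => //; apply/morph_graph_layout.
have shiftT k y : wang_shift T y -> wang_shift T (shift k y).
  by rewrite wang_shiftE; apply: nn_shift_shift.
apply/seteqP; split=> [y [/imT//|[x /imT xT <-]]|y yT]; first exact: shiftT.
case: (boolP (y 0%R \in M)) => y0; last by left; apply: onto.
(* The origin is moved to the base of its block. *)
right; exists (shift (- e_ i) y); last first.
  by apply/funext => n; rewrite /shift addrK.
apply: onto; first exact: shiftT.
apply/negP => /(markers_alternate (shiftT _ _ yT)).
by rewrite /shift add0r subrr y0.
Qed.

End Blocks.

Theorem theorem10 (C : choiceType) (T : {fset (wang_tile C)}) (i : axis)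
    (M : set T) :
  markers i M ->
  exists (C' : choiceType) (S : {fset (wang_tile C')}) (w : S -> word2 T),
    [/\ is_morphism (wang_shift S) (wang_shift T) w,
        range w `<=` (@letter T @` (~` M)) `|` concat_letters i (~` M) M,
        recognizable (wang_shift S) w &
        morph_image w (wang_shift S)
          `|` (shift (e_ i) @` morph_image w (wang_shift S)) = wang_shift T].
Proof.
move=> markersM.
pose E := @block_adj C T i M.
exists (block i M * block i M)%type, (edge_tiles E).
exists (@block_word C T i M \o center).
split.
- exact/is_morphism_center/is_morphism_block_word.
- by move=> _ [s _ <-]; apply: block_word_range; exists (center s).
- exact/recognizable_center/recognizable_block_word.
- by rewrite morph_image_center; apply: morph_image_block_word.
Qed.
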